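(* Let $G$ be a countable discrete amenable group, let $(\mathfrak{M}, \rho, G, \Xi)$ be an ergodic W*-dynamical system, and let $(\mathfrak{A}, G, \Theta; \iota)$ be a C*-model of $(\mathfrak{M}, \rho, G, \Xi)$ (not assumed faithful, i.e. $\iota$ need not be injective). Let $(F_k)_{k \in \mathbb{N}}$ be a Følner sequence for $G$. If $a \in \mathfrak{A}$ is a positive element, then the sequence $$\left( \left\| \frac{1}{|F_k|} \sum_{g \in F_k} \Xi_g(\iota(a)) \right\| \right)_{k \in \mathbb{N}}$$ converges, and its limit is $$m\left(a \,\vert\, \operatorname{Ann}(\ker \iota)\right) = \sup_{\phi \in \operatorname{Ann}(\ker \iota)} \phi(a),$$ where $\operatorname{Ann}(\ker\iota)$ is the set of $\Theta$-invariant states on $\mathfrak{A}$ that vanish on $\ker \iota$.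
   Context: Følner sequences and amenability: for a countable discrete group $G$, a Følner sequence for $G$ is a sequence $(F_k)_{k\in\mathbb{N}}$ of nonempty finite subsets of $G$ such that $\lim_{k\to\infty} \frac{|F_k \Delta F_k g|}{|F_k|} = 0$ for all $g \in G$ (this is the ''right'' Følner condition). $G$ is amenable if it admits a Følner sequence. A C*-dynamical system is a triple $(\mathfrak{A}, G, \Theta)$ consisting of a unital C*-algebra $\mathfrak{A}$, a countable discrete amenable group $G$, and an action $\Theta$ of $G$ on $\mathfrak{A}$ by *-automorphisms (so $\Theta_{gh} = \Theta_g \circ \Theta_h$). Denote by $\mathcal{S}^G$ the weak*-compact convex set of states $\phi$ on $\mathfrak{A}$ with $\phi = \phi\circ\Theta_g$ for all $g \in G$. For a compact convex subset $K \subseteq \mathcal{S}^G$ and positive $a \in \mathfrak{A}$, set $m(a \vert K) := \sup_{\phi\in K}\phi(a)$. A W*-dynamical system is a quadruple $(\mathfrak{M}, \rho, G, \Xi)$, where $\mathfrak{M}$ is a W*-algebra (von Neumann algebra) equipped with a faithful normal state $\rho$, and $\Xi$ is an action of the countable discrete amenable group $G$ on $\mathfrak{M}$ by *-automorphisms with $\rho = \rho\circ\Xi_g$ for all $g\in G$. It is ergodic if the only elements $x\in\mathfrak{M}$ with $\Xi_g x = x$ for all $g \in G$ are the scalar multiples of the identity. A C*-model of a W*-dynamical system $(\mathfrak{M}, \rho, G, \Xi)$ is a quadruple $(\mathfrak{A}, G, \Theta; \iota)$, where $(\mathfrak{A}, G, \Theta)$ is a C*-dynamical system and $\iota : \mathfrak{A}\to\mathfrak{M}$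 is a *-homomorphism such that $\Xi_g\circ\iota = \iota\circ\Theta_g$ for all $g \in G$ and $\iota(\mathfrak{A})$ is dense in $\mathfrak{M}$ in the weak operator topology. It is called faithful if $\iota$ is injective. $\operatorname{Ann}(\ker\iota) := \{\phi \in \mathcal{S}^G : \phi(b) = 0 \text{ for all } b \in \ker\iota\}$. The norm in the claim is the C*-norm of $\mathfrak{M}$. *)

(* Defs.v *)
From HB Require Import structures.
From mathcomp Require Import all_boot all_order all_algebra finmap complex.
From mathcomp Require Import all_classical all_reals all_analysis.

Set Implicit Arguments.
Unset Strict Implicit.
Unset Printing Implicit Defensive.

Import Order.TTheory GRing.Theory Num.Theory.
Import numFieldNormedType.Exports.

Local Open Scope classical_set_scope.
Local Open Scope ring_scope.

(* Unital complex C*-algebras.  [GRing.Algebra] forces 1 != 0; the zero algebra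
   has no states, so this excludes nothing here.  The C*-norm is a field of the
   mixin because a join of [GRing.Algebra] and [NormedModule] would sit below
   [Num.NumDomain] in the hierarchy, which HB does not accept. *)
HB.mixin Record isCStarAlgebra (R : realType) (A : Type)
    of GRing.Algebra R[i] A := {
  star : A -> A;
  starK : involutive star;
  starD : {morph star : x y / x + y};
  starZ : forall (c : R[i]) (x : A), star (c *: x) = c^* *: star x;
  starM : forall x y : A, star (x * y) = star y * star x;
  cnorm : A -> R;
  cnorm_eq0 : forall x : A, cnorm x = 0 -> x = 0;
  cnormZ : forall (c : R[i]) (x : A),
    cnorm (c *: x) = complex.Re `|c| * cnorm x;
  cnormD : forall x y : A, cnorm (x + y) <= cnorm x + cnorm y;
  cnormM : forall x y : A, cnorm (x * y) <= cnorm x * cnorm y;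
  cnorm_complete : forall u : nat -> A,
    (forall e : R, 0 < e ->
       \forall m \near \oo & n \near \oo, cnorm (u m - u n) < e) ->
    exists l : A, cnorm (u n - l) @[n --> \oo] --> (0 : R);
  cnorm_star : forall x : A, cnorm (star x * x) = cnorm x ^+ 2
}.

#[short(type="cstarAlgType")]
HB.structure Definition CStarAlgebra (R : realType) :=
  {A of isCStarAlgebra R A & GRing.Algebra R[i] A}.

(* Complex Hilbert spaces; the inner product is linear in its first argument. *)
HB.mixin Record isHilbert (R : realType) (H : Type)
    of CompleteNormedModule R[i] H := {
  inner : H -> H -> R[i];
  inner_linear : forall v : H, scalar (inner^~ v);
  inner_conj : forall u v : H, inner v u = (inner u v)^*;
  inner_norm : forall u : H, `|u| ^+ 2 = inner u u
}.

#[short(type="hilbertType")]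
HB.structure Definition Hilbert (R : realType) :=
  {H of isHilbert R H & CompleteNormedModule R[i] H}.

Section CStar.
Context {R : realType}.

Definition positive_elt {A : cstarAlgType R} (x : A) :=
  exists y : A, x = star y * y.

Record star_hom {A B : cstarAlgType R} (f : A -> B) : Prop := {
  star_hom_linear : linear f;
  star_hom_mul : {morph f : x y / x * y};
  star_hom_star : {morph f : x / star x}
}.

Record state {A : cstarAlgType R} (phi : A -> R[i]) : Prop := {
  state_linear : scalar phi;
  state_ge0 : forall x : A, positive_elt x -> 0 <= phi x;
  state1 : phi 1 = 1
}.

Definition faithful_state {A : cstarAlgType R} (phi : A -> R[i]) :=
  forall x : A, positive_elt x -> phi x = 0 -> x = 0.

Definition is_lub {A : cstarAlgType R} (D : set A) (s : A) :=
  (forall d, D d -> positive_elt (s - d)) /\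
  (forall u, (forall d, D d -> positive_elt (u - d)) -> positive_elt (u - s)).

(* Normality: preservation of suprema of upward directed sets of self-adjoint
   elements. *)
Definition normal {A : cstarAlgType R} (phi : A -> R[i]) :=
  forall (D : set A) (s : A),
    D !=set0 -> (forall d, D d -> star d = d) ->
    (forall d e, D d -> D e ->
       exists f, [/\ D f, positive_elt (f - d) & positive_elt (f - e)]) ->
    is_lub D s -> isLub (phi @` D) (phi s).

End CStar.

Section VonNeumann.
Context {R : realType} {H : hilbertType R}.

Definition bounded_operators : set (H -> H) :=
  [set T | linear T /\ continuous T].

(* The weak operator topology, here on all maps H -> H: the coarsest topology
   making every matrix coefficient T |-> <T u, v> continuous.  It induces the
   usual one on the bounded operators. *)
Definition matrix_coef (T : H -> H) : {ptws H * H -> R[i]^o} :=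
  fun p => inner (T p.1) p.2.

Definition wot := initial_topology matrix_coef.

Definition wot_closure (S : set (H -> H)) : set (H -> H) :=
  @closure wot S `&` bounded_operators.

(* [von_neumann iM]: iM identifies M with a von Neumann algebra on H, i.e. a
   WOT-closed *-subalgebra of B(H) containing the identity operator. *)
Record von_neumann {M : cstarAlgType R} (iM : M -> H -> H) : Prop := {
  vn_bounded : forall x, bounded_operators (iM x);
  vn_linear : forall u : H, linear (iM^~ u);
  vn_mul : forall x y : M, iM (x * y) = iM x \o iM y;
  vn_star : forall (x : M) (u v : H),
    inner (iM (star x) u) v = inner u (iM x v);
  vn_one : iM 1 = id;
  vn_inj : injective iM;
  vn_closed : wot_closure (range iM) `<=` range iM
}.

End VonNeumann.

Section Dynamics.
Context {R : realType} {G : groupType}.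

Definition right_translate (F : {fset G}) (g : G) : {fset G} :=
  [fset (h * g)%g | h in F]%fset.

Definition sym_diff (E F : {fset G}) : {fset G} :=
  ((E `\` F) `|` (F `\` E))%fset.

Record Folner (F : nat -> {fset G}) : Prop := {
  Folner_neq0 : forall k, F k != fset0;
  Folner_lim : forall g : G,
    (#|` sym_diff (F k) (right_translate (F k) g)|%:R / #|` F k|%:R : R)
      @[k --> \oo] --> (0 : R)
}.

Definition amenable := exists F : nat -> {fset G}, Folner F.

Record star_action {A : cstarAlgType R} (Theta : G -> A -> A) : Prop := {
  action_hom : forall g, star_hom (Theta g);
  action_bij : forall g, bijective (Theta g);
  action1 : Theta 1%g = id;
  actionM : forall g h, Theta (g * h)%g = Theta g \o Theta h
}.

Definition invariant_states {A : cstarAlgType R} (Theta : G -> A -> A) :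
    set (A -> R[i]) :=
  [set phi | state phi /\ forall g, phi \o Theta g = phi].

(* Values of states at positive elements are real, so taking real parts in
   this supremum only changes the type. *)
Definition msup {A : cstarAlgType R} (a : A) (K : set (A -> R[i])) : R :=
  sup [set complex.Re (phi a) | phi in K].

Record wstar_system {H : hilbertType R} {M : cstarAlgType R}
    (iM : M -> H -> H) (rho : M -> R[i]) (Xi : G -> M -> M) : Prop := {
  wsys_von_neumann : von_neumann iM;
  wsys_state : state rho;
  wsys_faithful : faithful_state rho;
  wsys_normal : normal rho;
  wsys_action : star_action Xi;
  wsys_invariant : forall g, rho \o Xi g = rho
}.

Definition ergodic {M : cstarAlgType R} (Xi : G -> M -> M) :=
  forall x : M, (forall g, Xi g x = x) -> exists c : R[i], x = c%:A.

Record cstar_model {H : hilbertType R} {M A : cstarAlgType R}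
    (iM : M -> H -> H) (Xi : G -> M -> M)
    (Theta : G -> A -> A) (iota : A -> M) : Prop := {
  model_action : star_action Theta;
  model_hom : star_hom iota;
  model_equivariant : forall g, Xi g \o iota = iota \o Theta g;
  model_dense : range iM `<=` wot_closure (range (iM \o iota))
}.

Definition Ann_ker {M A : cstarAlgType R}
    (Theta : G -> A -> A) (iota : A -> M) : set (A -> R[i]) :=
  invariant_states Theta `&`
  [set phi | forall b, iota b = 0 -> phi b = 0].

Definition average {M : cstarAlgType R} (Xi : G -> M -> M) (F : {fset G})
    (x : M) : M :=
  (#|` F|%:R : R[i])^-1 *: \sum_(g <- F) Xi g x.

End Dynamics.

Arguments Folner R {G} F.
Arguments amenable R G : clear implicits.

(* Main.v *)
Require Import Defs.
From HB Require Import structures.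
From mathcomp Require Import all_boot all_order all_algebra finmap complex.
From mathcomp Require Import all_classical all_reals all_analysis.
From mathcomp Require Import ring lra.
Import Order.TTheory GRing.Theory Num.Theory.
Import numFieldNormedType.Exports.
Local Open Scope classical_set_scope.
Local Open Scope ring_scope.

(* Every invariant state [phi] vanishing on [ker iota] satisfies
   [phi a = phi (A_k a) <= ||iota (A_k a)||], where [A_k] is the average over
   [F k]; this bounds the norms from below by [msup]. Conversely, if the norms
   exceeded [msup + e] infinitely often, vector states of [M] almost norming
   [A_k (iota a)], pulled back to [A] and averaged over [F k], would have an
   ultralimit that is invariant by the Folner condition, vanishes on [ker iota]
   and is at least [msup + e] at [a].

   Both halves rest on square roots in a C*-algebra. Instead of continuous
   functional calculus, [sqrt (1 - y)] with [||y|| <= 1] is obtained from the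
   iteration [z |-> (y + z^2) / 2], and positive square roots in [M] are shown to
   be unique by means of the action of [M] on [H]. *)

(** * Square roots in C*-algebras *)

Section NullSequences.
Context {R : realType}.

Lemma le_cvg0 (f : nat -> R) (b : R) :
  f n @[n --> \oo] --> (0 : R) -> (forall n, b <= f n) -> b <= 0.
Proof.
move=> f0 h; rewrite -(cvg_lim _ f0) //.
by apply: limr_ge; [exact: cvgP f0|exact: nearW].
Qed.

Lemma cvg0D (f g : nat -> R) : f n @[n --> \oo] --> (0 : R) ->
  g n @[n --> \oo] --> (0 : R) -> (f n + g n) @[n --> \oo] --> (0 : R).
Proof. by move=> f0 g0; rewrite -(addr0 0); exact: cvgD. Qed.

Lemma cvg0M (k : R) (f : nat -> R) : f n @[n --> \oo] --> (0 : R) ->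
  (k * f n) @[n --> \oo] --> (0 : R).
Proof. by move=> f0; rewrite -(mulr0 k); apply: cvgM => //; exact: cvg_cst. Qed.

End NullSequences.

Section CStarTheory.
Context {R : realType} {A : cstarAlgType R}.
Implicit Types (x y z s w : A) (t : R).

Lemma Re_norm_real t : complex.Re `|t%:C%C| = `|t|.
Proof. by rewrite normc_def /= expr0n /= addr0 sqrtr_sqr. Qed.

Lemma cnormZr t x : cnorm (t%:C%C *: x) = `|t| * cnorm x.
Proof. by rewrite cnormZ Re_norm_real. Qed.

Lemma cnorm0 : cnorm (0 : A) = 0.
Proof. by rewrite -(scaler0 _ 0) cnormZ normr0 mul0r. Qed.

Lemma cnormN x : cnorm (- x) = cnorm x.
Proof. by rewrite -scaleN1r cnormZ normrN1 mul1r. Qed.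

Lemma cnormB x y : cnorm (x - y) <= cnorm x + cnorm y.
Proof. by rewrite -(cnormN y) cnormD. Qed.

Lemma cnorm_ge0 x : 0 <= cnorm x.
Proof.
have := cnormB x x; rewrite subrr cnorm0 -mulr2n => h.
by rewrite -(pmulrn_lge0 _ (isT : (0 < 2)%N)).
Qed.

Lemma cnorm_distC x y : cnorm (x - y) = cnorm (y - x).
Proof. by rewrite -cnormN opprB. Qed.

Lemma cnorm_dist_trans z x y : cnorm (x - y) <= cnorm (x - z) + cnorm (z - y).
Proof. by apply: le_trans (cnormD _ _); rewrite addrA subrK. Qed.

Lemma star0 : star (0 : A) = 0.
Proof. by have := starZ 0 (0 : A); rewrite scale0r rmorph0 scale0r. Qed.

Lemma starN x : star (- x) = - star x.
Proof. by apply/eqP; rewrite -subr_eq0 opprK -starD addNr star0. Qed.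

Lemma starB x y : star (x - y) = star x - star y.
Proof. by rewrite starD starN. Qed.

Lemma starZr t x : star (t%:C%C *: x) = t%:C%C *: star x.
Proof. by rewrite starZ; congr (_ *: _); exact: conjc_real. Qed.

Lemma star1 : star (1 : A) = 1.
Proof. by rewrite -[LHS]mulr1 -{2}(starK (1 : A)) -starM mulr1 starK. Qed.

Lemma cnorm_starE x : cnorm (star x) = cnorm x.
Proof.
have le y : cnorm y <= cnorm (star y).
  have [->|y0] := eqVneq (cnorm y) 0; first exact: cnorm_ge0.
  have y_gt0 : 0 < cnorm y by rewrite lt_def y0 cnorm_ge0.
  by rewrite -(ler_pM2r y_gt0) -expr2 -cnorm_star cnormM.
by apply/le_anti; rewrite le andbT -{2}(starK x) le.
Qed.

Lemma cnorm_sqr x : star x = x -> cnorm (x * x) = cnorm x ^+ 2.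
Proof. by move=> {1}<-; rewrite cnorm_star. Qed.

Lemma cnorm_sqr_eq0 s : star s = s -> s * s = 0 -> s = 0.
Proof.
move=> ss /(congr1 cnorm); rewrite cnorm0 cnorm_sqr // => /eqP.
by rewrite expf_eq0 /= => /eqP/cnorm_eq0.
Qed.

Lemma positive_selfadj x : positive_elt x -> star x = x.
Proof. by move=> [y ->]; rewrite starM starK. Qed.

Lemma cnorm1 : cnorm (1 : A) = 1.
Proof.
have := cnorm_sqr 1 star1; rewrite mulr1 expr2 => h.
have /mulfI : cnorm (1 : A) != 0.
  by apply/eqP => /cnorm_eq0/eqP; rewrite oner_eq0.
by apply; rewrite -h mulr1.
Qed.

(* The coefficients of the nth iterate, a polynomial in [y], are nonnegative and
   those of the differences of consecutive iterates too; the value of the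
   iterate at [y = 1] therefore controls everything. The limit is
   [1 - sqrt (1 - y)]. *)
Fixpoint sqrt_iter y n : A :=
  if n is m.+1 then (2^-1)%:C%C *: (y + sqrt_iter y m * sqrt_iter y m) else 0.

Fixpoint sqrt_bound n : R :=
  if n is m.+1 then 2^-1 * (1 + sqrt_bound m * sqrt_bound m) else 0.

Lemma sqrt_iterS y n :
  sqrt_iter y n.+1 = (2^-1)%:C%C *: (y + sqrt_iter y n * sqrt_iter y n).
Proof. by []. Qed.

Lemma sqrt_boundS n :
  sqrt_bound n.+1 = 2^-1 * (1 + sqrt_bound n * sqrt_bound n).
Proof. by []. Qed.

Lemma sqrt_bound_itv n : 0 <= sqrt_bound n <= 1.
Proof. by elim: n => [|n /andP[h0 h1]] /=; [rewrite lexx ler01|nra]. Qed.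

Lemma sqrt_bound_step n : sqrt_bound n <= sqrt_bound n.+1.
Proof. have := sqrt_bound_itv n => /= h; nra. Qed.

Lemma sqrt_bound_cvg : exists l : R, sqrt_bound n @[n --> \oo] --> l.
Proof.
apply/cvg_ex; apply: nondecreasing_is_cvgn.
  by apply/nondecreasing_seqP => n; exact: sqrt_bound_step.
by exists 1 => _ [n _ <-]; case/andP: (sqrt_bound_itv n).
Qed.

Lemma sqrt_iter_comm y x n : x * y = y * x ->
  x * sqrt_iter y n = sqrt_iter y n * x.
Proof.
move=> xy; elim: n => [|n IH] /=; first by rewrite mulr0 mul0r.
by rewrite -scalerAr -scalerAl mulrDr mulrDl xy mulrA IH -!mulrA IH.
Qed.

Lemma sqrt_iter_star y n : star y = y -> star (sqrt_iter y n) = sqrt_iter y n.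
Proof.
by move=> ys; elim: n => [|n IH] /=; rewrite ?star0 // starZr starD starM IH ys.
Qed.

Section Iteration.
Variable y : A.
Hypothesis y_le1 : cnorm y <= 1.

Lemma sqrt_iter_le n : cnorm (sqrt_iter y n) <= sqrt_bound n.
Proof.
elim: n => [|n IH] /=; first by rewrite cnorm0.
rewrite cnormZr gtr0_norm ?invr_gt0 // ler_pM2l ?invr_gt0 //.
apply: le_trans (cnormD _ _) _; apply: lerD => //.
by apply: le_trans (cnormM _ _) _; apply: ler_pM => //; exact: cnorm_ge0.
Qed.

(** Iterates commute, so a difference of squares factors; the scalar recursion factors in the same
    way, and induction compares the two factor by factor. *)
Lemma sqrt_iter_step n :
  cnorm (sqrt_iter y n.+1 - sqrt_iter y n) <= sqrt_bound n.+1 - sqrt_bound n.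
Proof.
elim: n => [|n IH].
  have := sqrt_iter_le 1; by rewrite /= !subr0.
rewrite sqrt_iterS [in X in _ - X]sqrt_iterS -scalerBr opprD addrACA subrr add0r.
have -> : sqrt_bound n.+2 - sqrt_bound n.+1 = 2^-1 *
    ((sqrt_bound n.+1 - sqrt_bound n) * (sqrt_bound n.+1 + sqrt_bound n)).
  rewrite sqrt_boundS [in X in _ - X]sqrt_boundS; ring.
rewrite cnormZr gtr0_norm ?invr_gt0 // ler_pM2l ?invr_gt0 //.
have c : sqrt_iter y n.+1 * sqrt_iter y n = sqrt_iter y n * sqrt_iter y n.+1.
  by apply: sqrt_iter_comm; apply/esym; exact: sqrt_iter_comm.
set a := sqrt_iter y n.+1 in IH c *; set b := sqrt_iter y n in IH c *.
have -> : a * a - b * b = (a - b) * (a + b).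
  by rewrite mulrBl !mulrDr c opprD addrA addrK.
apply: le_trans (cnormM _ _) _; apply: ler_pM; rewrite ?cnorm_ge0 //.
by apply: le_trans (cnormD _ _) _; apply: lerD; exact: sqrt_iter_le.
Qed.

Lemma sqrt_iter_dist m n : (m <= n)%N ->
  cnorm (sqrt_iter y n - sqrt_iter y m) <= sqrt_bound n - sqrt_bound m.
Proof.
move=> /subnK<-; elim: (n - m)%N => [|k IH]; first by rewrite !subrr cnorm0.
rewrite addSn; apply: le_trans (cnorm_dist_trans (sqrt_iter y (k + m)) _ _) _.
rewrite -[leRHS](subrKA (sqrt_bound (k + m))).
by apply: lerD => //; exact: sqrt_iter_step.
Qed.

Lemma sqrt_iter_cvg : exists z, cnorm (sqrt_iter y n - z) @[n --> \oo] --> (0 : R).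
Proof.
apply: cnorm_complete => e e0; have [l lP] := sqrt_bound_cvg.
have e2 : 0 < e / 2 by rewrite divr_gt0.
move/cvgrPdist_lt: lP => /(_ _ e2) nearl.
exists ([set n | `|l - sqrt_bound n| < e / 2], [set n | `|l - sqrt_bound n| < e / 2]).
  by split.
move=> [m n] /= [mP nP].
have : `|sqrt_bound m - sqrt_bound n| < e.
  rewrite (splitr e) (le_lt_trans (ler_distD l _ _)) // ltrD //.
  by rewrite distrC.
apply: le_lt_trans; case: (leqP n m) => [nm|/ltnW mn].
  exact: le_trans (sqrt_iter_dist _ _ nm) (ler_norm _).
rewrite distrC cnorm_distC.
exact: le_trans (sqrt_iter_dist _ _ mn) (ler_norm _).
Qed.

End Iteration.

Lemma cnorm_le_cvg0_eq (f : nat -> R) x y :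
  f n @[n --> \oo] --> (0 : R) -> (forall n, cnorm (x - y) <= f n) -> x = y.
Proof.
move=> f0 h; apply/eqP; rewrite -subr_eq0; apply/eqP/cnorm_eq0/le_anti.
by rewrite cnorm_ge0 andbT (le_cvg0 _ _ f0).
Qed.

(** Self-adjointness, the norm bound and commutation pass from the iterates to their limit [z]. The
    bound on [z] is kept so that [1 - z] has a square root in turn. *)
Lemma one_sub_sqrt_exists y : star y = y -> cnorm y <= 1 ->
  exists z, [/\ star z = z, cnorm z <= 1, (1 - z) * (1 - z) = 1 - y &
    forall x, x * y = y * x -> x * z = z * x].
Proof.
move=> ys y1; have [z zP] := sqrt_iter_cvg y y1.
set u := sqrt_iter y in zP.
have zn n : cnorm (u n) <= 1.
  apply: le_trans (sqrt_iter_le y y1 n) _.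
  by case/andP: (sqrt_bound_itv n).
have z1 : cnorm z <= 1.
  rewrite -subr_le0; apply: (le_cvg0 _ _ zP) => n.
  have := cnorm_dist_trans (u n) z 0; rewrite !subr0 (cnorm_distC z).
  have := zn n; lra.
have zc x : x * y = y * x -> x * z = z * x.
  move=> xy; have c := cvg0M (cnorm x) _ (cvg0D _ _ zP zP).
  apply: (cnorm_le_cvg0_eq _ _ _ c) => n /=.
  apply: le_trans (cnorm_dist_trans (x * u n) _ _) _.
  rewrite mulrDr {2}[x * u n](sqrt_iter_comm y x n xy) -mulrBr -mulrBl.
  apply: lerD; apply: le_trans (cnormM _ _) _.
    by rewrite (cnorm_distC z).
  by rewrite mulrC.
have zs : star z = z.
  have c := cvg0D _ _ zP zP.
  apply: (cnorm_le_cvg0_eq _ _ _ c) => n /=.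
  apply: le_trans (cnorm_dist_trans (u n) _ _) _; apply: lerD => //.
  rewrite -[u n](sqrt_iter_star y n ys) -starB cnorm_starE.
  by rewrite sqrt_iter_star // cnorm_distC.
exists z; split=> //.
(* The fixed-point equation of the iteration, in the form that rearranges to [(1 - z)^2 = 1 - y]. *)
suff e : z + z = y + z * z.
  have -> : (1 - z) * (1 - z) = 1 - (z + z) + z * z.
    by rewrite mulrBr mulr1 mulrBl mul1r opprB opprD !addrA addrAC.
  by rewrite e opprD addrA subrK.
suff e : z = (2^-1)%:C%C *: (y + z * z).
  rewrite {1 2}e -scalerDl -rmorphD /=.
  have -> : 2^-1 + 2^-1 = 1 :> R by field.
  by rewrite scale1r.
have zP1 : cnorm (u n.+1 - z) @[n --> \oo] --> (0 : R).
  by rewrite (cvg_shiftS (fun n => cnorm (u n - z))).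
have c := cvg0D _ _ zP1 zP.
apply: (cnorm_le_cvg0_eq _ _ _ c) => n /=.
apply: le_trans (cnorm_dist_trans (u n.+1) _ _) _; apply: lerD.
  by rewrite cnorm_distC.
rewrite /u /= -/(u n) -scalerBr opprD addrACA subrr add0r.
have cm : u n * z = z * u n.
  by apply: zc; apply/esym; exact: sqrt_iter_comm.
have -> : u n * u n - z * z = (u n - z) * (u n + z).
  by rewrite mulrBl !mulrDr cm opprD addrA addrK.
rewrite cnormZr gtr0_norm ?invr_gt0 //.
(* The bound [||u n + z|| <= 2] absorbs the factor 1/2. *)
have := cnormM (u n - z) (u n + z); have := cnormD (u n) z.
have := zn n; have := cnorm_ge0 (u n - z); nra.
Qed.

Lemma sqrt_exists y : star y = y -> cnorm y <= 1 ->
  exists w, [/\ star w = w, w * w = 1 - y &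
    forall x, x * y = y * x -> x * w = w * x].
Proof.
move=> ys y1; have [z [zs _ zz zc]] := one_sub_sqrt_exists y ys y1.
exists (1 - z); split=> [|//|x /zc xz]; first by rewrite starB star1 zs.
by rewrite mulrBr mulrBl mulr1 mul1r xz.
Qed.

(* [v + i w] is a multiple of a unitary, and [v] is its real part. *)
Lemma cnorm_sqr_le v w t : 0 <= t -> star v = v -> star w = w ->
  v * w = w * v -> v * v + w * w = t%:C%C *: 1 -> cnorm (v * v) <= t.
Proof.
move=> t0 vs ws vw e.
set u := v + 'i%C *: w.
have us : star u = v - 'i%C *: w.
  by rewrite starD starZ vs ws complexiE conjCi scaleNr.
have uu : star u * u = t%:C%C *: 1.
  rewrite us mulrBl !mulrDr !(=^~ scalerAl, =^~ scalerAr) vw scalerA.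
  rewrite -['i%C * _]expr2 sqr_i.
  by rewrite scaleN1r opprD opprK addrA addrK.
have nu : cnorm u ^+ 2 = t by rewrite -cnorm_star uu cnormZr cnorm1 mulr1 ger0_norm.
have nv : cnorm v <= cnorm u.
  have -> : v = (2^-1)%:C%C *: (u + star u).
    rewrite us addrACA subrr addr0 scalerDr -scalerDl -rmorphD /=.
    have -> : 2^-1 + 2^-1 = 1 :> R by field.
    by rewrite scale1r.
  rewrite cnormZr gtr0_norm ?invr_gt0 //.
  have := cnormD u (star u); rewrite cnorm_starE; lra.
by rewrite cnorm_sqr // -nu lerXn2r // nnegrE cnorm_ge0.
Qed.

(** Here [w * w] is the absolute value of [s]; presenting it as a square records its positivity. *)
Lemma abs_sqrt_exists s : star s = s ->
  exists w, [/\ star w = w, (w * w) * (w * w) = s * s &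
    forall x, x * s = s * x -> x * w = w * x].
Proof.
(* The summand 1 keeps the scaling factor invertible when [s = 0]. *)
move=> ss; set C := cnorm s + 1.
have C0 : 0 < C by have := cnorm_ge0 s; rewrite /C; lra.
set s' := (C^-1)%:C%C *: s.
have s's : star s' = s' by rewrite starZr ss.
have s'1 : cnorm s' <= 1.
  rewrite cnormZr gtr0_norm ?invr_gt0 // mulrC ler_pdivrMr // mul1r /C; lra.
have s2s : star (s' * s') = s' * s' by rewrite starM s's.
have comm_s' x : x * s = s * x -> x * s' = s' * x.
  by move=> xs; rewrite -scalerAr -scalerAl xs.
have s21 : cnorm (s' * s') <= 1.
  by rewrite cnorm_sqr // exprn_ile1 // cnorm_ge0.
(* Three nested roots: [r = sqrt (1 - s'^2)], then [1 - z = sqrt (1 - r^2)], which is [|s'|], then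
   [w = sqrt (1 - z)]. *)
have [r [rs rr rc]] := sqrt_exists (s' * s') s2s s21.
have r1 : cnorm (r * r) <= 1.
  apply: (@cnorm_sqr_le r s' 1) => //.
    by apply/esym/rc; rewrite mulrA.
  by rewrite rr subrK scale1r.
have rrs : star (r * r) = r * r by rewrite starM rs.
have [z [zs z1 zz zc]] := one_sub_sqrt_exists (r * r) rrs r1.
have [w [ws ww wc]] := sqrt_exists z zs z1.
have wC : (Num.sqrt C)%:C%C *: w * ((Num.sqrt C)%:C%C *: w) = C%:C%C *: (w * w).
  by rewrite -scalerAl -scalerAr scalerA -rmorphM /= -expr2 sqr_sqrtr // ltW.
exists ((Num.sqrt C)%:C%C *: w); split.
- by rewrite starZr ws.
- rewrite wC ww -scalerAl -scalerAr zz rr opprB addrCA subrr addr0.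
  rewrite -scalerAl -scalerAr !scalerA -!rmorphM /=.
  have -> : C * C / C / C = 1 by field; rewrite gt_eqF.
  by rewrite scale1r.
- move=> x xs; have x' : x * s' = s' * x := comm_s' x xs.
  rewrite -scalerAr -scalerAl; congr (_ *: _); apply: wc; apply: zc.
  have xr : x * r = r * x by apply: rc; rewrite mulrA x' -!mulrA x'.
  by rewrite mulrA xr -!mulrA xr.
Qed.

(** Turns a norm bound into positivity, the form in which states can use it. *)
Lemma cnorm_le_sqrt x t : star x = x -> cnorm x <= t -> 0 < t ->
  exists w, star w = w /\ w * w = t%:C%C *: 1 - x.
Proof.
move=> xs xt t0; have ys : star ((t^-1)%:C%C *: x) = (t^-1)%:C%C *: x.
  by rewrite starZr xs.
have y1 : cnorm ((t^-1)%:C%C *: x) <= 1.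
  by rewrite cnormZr gtr0_norm ?invr_gt0 // mulrC ler_pdivrMr // mul1r.
have [w [ws ww _]] := sqrt_exists _ ys y1.
exists ((Num.sqrt t)%:C%C *: w); split; first by rewrite starZr ws.
rewrite -scalerAl -scalerAr scalerA -rmorphM /= -expr2 sqr_sqrtr ?ltW //.
by rewrite ww scalerBr scalerA -rmorphM /= divff ?gt_eqF // scale1r.
Qed.

End CStarTheory.

(** * Linear maps and bounds on states *)

Section Linear.
Context {K : nzRingType} {U V : lmodType K} {f : U -> V} (lf : linear f).

Lemma linearfD : {morph f : x y / x + y}.
Proof. by move=> x y; rewrite -{1}(scale1r x) lf scale1r. Qed.

Lemma linearf0 : f 0 = 0.
Proof. by apply: (addrI (f 0)); rewrite -linearfD !addr0. Qed.

Lemma linearfZ k : {morph f : x / k *: x}.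
Proof. by move=> x; rewrite -(addr0 (k *: x)) lf linearf0 addr0. Qed.

Lemma linearfN : {morph f : x / - x}.
Proof. by move=> x; rewrite -scaleN1r linearfZ scaleN1r. Qed.

Lemma linearfB : {morph f : x y / x - y}.
Proof. by move=> x y; rewrite linearfD linearfN. Qed.

Lemma linearf_sum (I : Type) (r : seq I) (E : I -> U) :
  f (\sum_(i <- r) E i) = \sum_(i <- r) f (E i).
Proof. exact: (big_morph f linearfD linearf0). Qed.

End Linear.

Section Scalar.
Context {K : nzRingType} {U : lmodType K} {f : U -> K} (lf : scalar f).

Let lf' : linear (f : U -> K^o) := lf.

Lemma scalarfD : {morph f : x y / x + y}.
Proof. exact: linearfD lf'. Qed.

Lemma scalarfZ k x : f (k *: x) = k * f x.
Proof. exact: (linearfZ lf' k x). Qed.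

Lemma scalarf0 : f 0 = 0.
Proof. exact: linearf0 lf'. Qed.

Lemma scalarfB : {morph f : x y / x - y}.
Proof. exact: linearfB lf'. Qed.

Lemma scalarf_sum (I : Type) (r : seq I) (E : I -> U) :
  f (\sum_(i <- r) E i) = \sum_(i <- r) f (E i).
Proof. exact: (linearf_sum lf'). Qed.

End Scalar.

Section States.
Context {R : realType} {A : cstarAlgType R} {phi : A -> R[i]} (st : state phi).

Let lphi := state_linear st.

Lemma state_sqr_ge0 w : star w = w -> 0 <= phi (w * w).
Proof. by move=> ws; apply: (state_ge0 st); exists w; rewrite ws. Qed.

(** The slack 1 makes the constant strictly positive, as the square root requires; a bound uniform
    in the state is the aim, not a sharp one. *)
Lemma state_selfadj_le h : star h = h -> phi h <= (cnorm h + 1)%:C%C.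
Proof.
move=> hs; have C0 : 0 < cnorm h + 1 by have := cnorm_ge0 h; lra.
have [|w [ws ww]] := cnorm_le_sqrt h _ hs _ C0; first by rewrite lerDl.
have := state_sqr_ge0 w ws; rewrite ww (scalarfB lphi) (scalarfZ lphi) (state1 st).
by rewrite mulr1 subr_ge0.
Qed.

Lemma state_selfadj_bound h : star h = h ->
  complex.Im (phi h) = 0 /\ `|complex.Re (phi h)| <= cnorm h + 1.
Proof.
move=> hs; have := state_selfadj_le h hs.
have := state_selfadj_le (- h); rewrite starN hs cnormN => /(_ erefl).
rewrite -sub0r (scalarfB lphi) (scalarf0 lphi) sub0r.
(* The order on [R[i]] compares only numbers with equal imaginary parts, so comparison with a real
   number forces [phi h] to be real. *)
case: (phi h) => a b; rewrite !lecE /= => /andP[_ h1] /andP[/eqP<- h2].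
by split=> //; rewrite ler_norml; apply/andP; split; lra.
Qed.

Lemma state_bound b : `|complex.Re (phi b)| <= cnorm b + 1 /\
  `|complex.Im (phi b)| <= cnorm b + 1.
Proof.
(* The self-adjoint real and imaginary parts of [b]. *)
pose h := (2^-1)%:C%C *: (b + star b).
pose k := (2^-1)%:C%C *: ('i%C *: (star b - b)).
have hs : star h = h by rewrite starZr starD starK addrC.
have ks : star k = k.
  by rewrite starZr starZ starB starK complexiE conjCi scaleNr -scalerN opprB.
have bE : b = h + 'i%C *: k.
  have -> : 'i%C *: k = (2^-1)%:C%C *: (b - star b).
    rewrite !scalerA mulrAC -expr2 sqr_i mulN1r.
    by rewrite scaleNr -scalerN opprB.
  rewrite -scalerDr addrACA subrr addr0 scalerDr -scalerDl -rmorphD /=.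
  have -> : 2^-1 + 2^-1 = 1 :> R by field.
  by rewrite scale1r.
have hn : cnorm h <= cnorm b.
  rewrite cnormZr gtr0_norm ?invr_gt0 //.
  have := cnormD b (star b); rewrite cnorm_starE; lra.
have kn : cnorm k <= cnorm b.
  rewrite cnormZr gtr0_norm ?invr_gt0 // cnormZ.
  have -> : complex.Re `|'i%C : R[i]| = 1.
    by rewrite normc_def /= expr0n expr1n add0r sqrtr1.
  have := cnormB (star b) b; rewrite cnorm_starE; lra.
have [h0 hb] := state_selfadj_bound h hs.
have [k0 kb] := state_selfadj_bound k ks.
have -> : phi b = phi h + 'i%C * phi k.
  by rewrite {1}bE (scalarfD lphi) [phi ('i%C *: _)](scalarfZ lphi).
move: h0 hb k0 kb; case: (phi h) => a ? /= -> hb; case: (phi k) => c ? /= -> kb.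
rewrite !(mul0r, mul1r, mulr0, subr0, addr0, add0r).
by split; [move: hb hn|move: kb kn]; lra.
Qed.

End States.

(** * Positive elements of von Neumann algebras *)

Section VonNeumann.
Context {R : realType} {H : hilbertType R}.

Lemma inner_ge0 (u : H) : 0 <= inner u u.
Proof. by rewrite -inner_norm exprn_ge0. Qed.

Lemma inner_eq0 (u : H) : inner u u = 0 -> u = 0.
Proof.
by rewrite -inner_norm => /eqP; rewrite expf_eq0 /= normr_eq0 => /eqP.
Qed.

Lemma inner0l (v : H) : inner 0 v = 0.
Proof. exact: scalarf0 (inner_linear v). Qed.

Context {M : cstarAlgType R} {iM : M -> H -> H} (vn : von_neumann iM).
Implicit Types (x s w T : M) (u : H).

Lemma vn_eq0 x : (forall u, iM x u = 0) -> x = 0.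
Proof.
move=> h; apply: (vn_inj vn); apply/funext => u.
by rewrite h (linearf0 (vn_linear vn u)).
Qed.

Lemma form_scalar u : scalar (fun x => inner (iM x u) u).
Proof. by move=> c x y; rewrite (vn_linear vn) inner_linear. Qed.

Lemma form1 u : inner (iM 1 u) u = inner u u.
Proof. by rewrite (vn_one vn). Qed.

Lemma form_conj d x u : star d = d ->
  inner (iM (d * x * d) u) u = inner (iM x (iM d u)) (iM d u).
Proof.
by move=> ds; rewrite !(vn_mul vn) /= -{1}ds (vn_star vn).
Qed.

Lemma form_star_mul x u :
  inner (iM (star x * x) u) u = inner (iM x u) (iM x u).
Proof. by rewrite (vn_mul vn) /= (vn_star vn). Qed.

(* Uniqueness of the positive square root: for [d = w^2 - s] both positive terms
   of [d w^2 d + d s d = 0] vanish. *)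
Lemma pos_sqrt_unique s w : star s = s -> star w = w -> w * s = s * w ->
  (w * w) * (w * w) = s * s -> (forall u, 0 <= inner (iM s u) u) -> w * w = s.
Proof.
move=> ss ws wsc e s_ge0; set p := w * w in e *.
have ps : star p = p by rewrite starM ws.
have psc : p * s = s * p by rewrite /p -mulrA wsc !mulrA wsc.
set d := p - s; have ds : star d = d by rewrite starB ps ss.
have dsum : (p + s) * d = 0.
  by rewrite mulrBr !mulrDl psc e opprD addrA addrK subrr.
have wd0 : w * d = 0.
  apply: vn_eq0 => u; rewrite (vn_mul vn) /=; apply: inner_eq0.
  set v := iM d u; rewrite -form_star_mul ws -/p.
  have : inner (iM p v) v + inner (iM s v) v = 0.
    rewrite -(scalarfD (form_scalar v)) -form_conj // -mulrA dsum mulr0.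
    exact: scalarf0 (form_scalar u).
  have pv : 0 <= inner (iM p v) v by rewrite /p -{1}ws form_star_mul inner_ge0.
  by move/eqP; rewrite paddr_eq0 // => /andP[/eqP].
have pd0 : p * d = 0 by rewrite -mulrA wd0 mulr0.
have sd0 : s * d = 0 by move: dsum; rewrite mulrDl pd0 add0r.
apply/eqP; rewrite -subr_eq0; apply/eqP; apply: cnorm_sqr_eq0 => //.
by rewrite -/d {1}/d mulrBl pd0 sd0 subrr.
Qed.

(** Uniqueness of the positive root of [s * s] identifies the absolute value of [s] with [s]. *)
Lemma form_sqrt_exists s : star s = s -> (forall u, 0 <= inner (iM s u) u) ->
  exists w, [/\ star w = w, w * w = s & forall x, x * s = s * x -> x * w = w * x].
Proof.
move=> ss s_ge0; have [w [ws ww wc]] := abs_sqrt_exists s ss.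
by exists w; split=> //; apply: pos_sqrt_unique => //; apply/esym/wc.
Qed.

(** Links the abstract norm of [M] to the forms on [H]: [T] and [t - T] have commuting self-adjoint
    roots [v] and [w] with [v^2 + w^2 = t]. *)
Lemma cnorm_le_form T t : star T = T -> 0 <= t ->
  (forall u, 0 <= inner (iM T u) u <= t%:C%C * inner u u) -> cnorm T <= t.
Proof.
move=> Ts t0 T_itv.
have [|v [vs vv _]] := form_sqrt_exists T Ts.
  by move=> u; case/andP: (T_itv u).
have tTs : star (t%:C%C *: 1 - T) = t%:C%C *: 1 - T.
  by rewrite starB starZr star1 Ts.
have [|w [ws ww wc]] := form_sqrt_exists _ tTs.
  move=> u; rewrite (scalarfB (form_scalar u)) (scalarfZ (form_scalar u)) form1.
  by rewrite subr_ge0; case/andP: (T_itv u).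
rewrite -vv; apply: (cnorm_sqr_le v w) => //.
  apply: wc; rewrite mulrBr mulrBl -scalerAr -scalerAl mulr1 mul1r -vv.
  by rewrite mulrA.
by rewrite vv ww addrC subrK.
Qed.

Lemma vector_state u : u != 0 ->
  state (fun x => (inner u u)^-1 * inner (iM x u) u).
Proof.
move=> u0; split.
- by move=> c x y; rewrite form_scalar mulrDr mulrCA.
- move=> _ [y ->]; rewrite form_star_mul mulr_ge0 ?invr_ge0 ?inner_ge0 //.
- rewrite form1 mulVf //; apply: contra u0 => /eqP/inner_eq0->//.
Qed.

End VonNeumann.

Section Homomorphisms.
Context {R : realType} {A B : cstarAlgType R} {f : A -> B}.
Hypotheses (hf : star_hom f) (f1 : f 1 = 1).

Lemma state_comp (phi : B -> R[i]) : state phi -> state (phi \o f).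
Proof.
move=> st; split=> [c x y|_ [y ->]|] /=.
- by rewrite (star_hom_linear hf) (state_linear st).
- apply: (state_ge0 st); exists (f y).
  by rewrite (star_hom_mul hf) (star_hom_star hf).
- by rewrite f1 (state1 st).
Qed.

End Homomorphisms.

(* If [t - f x = r^2] then the element [w^2] of [A] lying over it satisfies
   [w^2 - (t - x) \in ker f]. *)
Lemma state_le_cnorm {R : realType} {H : hilbertType R} {M A : cstarAlgType R}
    {iM : M -> H -> H} (vn : von_neumann iM) {f : A -> M} (hf : star_hom f)
    (f1 : f 1 = 1) (phi : A -> R[i]) (st : state phi)
    (phi0 : forall b, f b = 0 -> phi b = 0) x : star x = x ->
  complex.Re (phi x) <= cnorm (f x).
Proof.
(* The margin [e] keeps [t] positive even when [f x = 0]. *)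
move=> xs; apply/ler_addgt0Pr => e e0.
have lf := star_hom_linear hf; set t := cnorm (f x) + e.
have t0 : 0 < t by rewrite ltr_wpDl // cnorm_ge0.
have fxs : star (f x) = f x by rewrite -(star_hom_star hf) xs.
have [|r [rs rr]] := cnorm_le_sqrt (f x) t fxs _ t0.
  by rewrite lerDl ltW.
set s := t%:C%C *: 1 - x.
have ss : star s = s by rewrite starB starZr star1 xs.
have fs : f s = r * r by rewrite rr (linearfB lf) (linearfZ lf) f1.
have [w [ws ww wc]] := abs_sqrt_exists s ss.
(* Only the image [f s] is known to be positive, so [s] is replaced by its absolute value [w * w],
   which [f] cannot distinguish from [s]. *)
have : f w * f w = f s.
  apply: (pos_sqrt_unique vn).
  - by rewrite -(star_hom_star hf) ss.
  - by rewrite -(star_hom_star hf) ws.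
  - by rewrite -!(star_hom_mul hf) wc.
  - by rewrite -!(star_hom_mul hf) ww.
  - by move=> u; rewrite fs -{1}rs (form_star_mul vn) inner_ge0.
rewrite -(star_hom_mul hf) => /eqP; rewrite -subr_eq0 -(linearfB lf).
have lphi := state_linear st.
move=> /eqP/phi0; rewrite (scalarfB lphi) => /eqP; rewrite subr_eq0 => /eqP ps.
have := state_sqr_ge0 st w ws.
rewrite ps (scalarfB lphi) (scalarfZ lphi) (state1 st) mulr1 subr_ge0 lecE.
by case/andP.
Qed.

(** * Weak density makes the model unital *)

Section WeakDensity.
Context {R : realType} {G : groupType} {H : hilbertType R} {M : cstarAlgType R}.
Context {iM : M -> H -> H} (vn : von_neumann iM).

Lemma wot_coef_closed (u w : H) :
  closed ([set T : wot | inner (T u) w = 0] : set (@wot R H)).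
Proof.
pose g : @wot R H -> R[i]^o :=
  (fun f : {ptws H * H -> R[i]^o} => f (u, w)) \o matrix_coef.
have cg : continuous g.
  move=> T; apply: (@continuous_comp (@wot R H) {ptws H * H -> R[i]^o} R[i]^o).
    exact: (@initial_continuous _ _ (@matrix_coef R H) T).
  exact: (@proj_continuous _ (fun=> R[i]^o) (u, w)).
have -> : [set T : @wot R H | inner (T u) w = 0] = g @^-1` [set 0] by [].
apply: closed_comp => [T _|]; first exact: cg.
exact: (accessible_closed_set1 (hausdorff_accessible (@norm_hausdorff _ R[i]^o))).
Qed.

(** The element [p = 1 - iota 1] kills the range of [iota] from the left, hence by density also the
    identity. *)
Lemma model_unital {A : cstarAlgType R} {Xi : G -> M -> M} {Theta : G -> A -> A}
  {iota : A -> M} : cstar_model iM Xi Theta iota -> iota 1 = 1.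
Proof.
move=> mod; apply/esym/eqP; rewrite -subr_eq0; apply/eqP.
set p := 1 - iota 1.
apply: (vn_eq0 vn) => u; apply: inner_eq0; set v := iM p u.
(* Moving [p] to the other side leaves a matrix coefficient of the identity operator, to which
   density applies. *)
rewrite {1}/v -(starK p) (vn_star vn); set w := iM (star p) v.
have [cl _] : wot_closure (range (iM \o iota)) (id : H -> H).
  by apply: (model_dense mod); exists 1 => //; exact: vn_one vn.
apply: (wot_coef_closed u w); move: cl; apply: closure_subset => _ [x _ <-] /=.
rewrite /w -(vn_star vn) starK.
have /= <- := congr1 (fun h => h u) (vn_mul vn p (iota x)).
rewrite mulrBl mul1r -(star_hom_mul (model_hom mod)) mul1r subrr.
by rewrite (linearf0 (vn_linear vn u)) inner0l.
Qed.

End WeakDensity.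

(** * Limits of averaged states *)

Section UltraLimits.
Context {R : realType}.

Lemma ultra_bounded_cvg (U : set_system nat) (f : nat -> R) K :
  UltraFilter U -> (forall k, `|f k| <= K) -> exists l : R, f @ U --> l.
Proof.
move=> ultraU fK; have PU := ultra_proper.
have [|l [_ cl]] := @segment_compact R (- K) K (f @ U) _.
  by apply: (@filterE _ U) => k; rewrite /= in_itv /= -ler_norml.
(* An ultrafilter converges to each of its cluster points: otherwise the complement of a
   neighbourhood would belong to it. *)
exists l => N lN; case: (in_ultra_setVsetC (f @^-1` N) ultraU) => // UN.
by have [x [] ] := cl (~` N) N UN lN.
Qed.

(** Plays the part of weak* compactness of the state space: [state_bound] gives pointwise limits,
    and each axiom of a state is a closed condition. Real and imaginary parts are treated apart to
    stay with real limits. *)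
Lemma state_ultralimit {A : cstarAlgType R} (U : set_system nat)
    (phi : nat -> A -> R[i]) :
  UltraFilter U -> (forall k, state (phi k)) ->
  exists psi : A -> R[i], state psi /\ forall b,
    complex.Re (phi k b) @[k --> U] --> complex.Re (psi b) /\
    complex.Im (phi k b) @[k --> U] --> complex.Im (psi b).
Proof.
move=> ultraU st; have PU := ultra_proper.
have /choice[psi psiP] (b : A) : exists z : R[i],
    complex.Re (phi k b) @[k --> U] --> complex.Re z /\
    complex.Im (phi k b) @[k --> U] --> complex.Im z.
  have [|r rP] :=
    @ultra_bounded_cvg U (fun k => complex.Re (phi k b)) (cnorm b + 1) ultraU.
    by move=> k; case: (state_bound (st k) b).
  have [|i iP] :=
    @ultra_bounded_cvg U (fun k => complex.Im (phi k b)) (cnorm b + 1) ultraU.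
    by move=> k; case: (state_bound (st k) b).
  by exists (r +i* i)%C.
exists psi; split => //.
have psi_eq b z : complex.Re (phi k b) @[k --> U] --> complex.Re z ->
    complex.Im (phi k b) @[k --> U] --> complex.Im z -> psi b = z.
  have [hr hi] := psiP b => zr zi; apply/eqP; rewrite eq_complex; apply/andP; split.
    by apply/eqP; exact: (cvg_unique _ hr zr).
  by apply/eqP; exact: (cvg_unique _ hi zi).
split=> [c x y|x x0|].
- have [xr xi] := psiP x; have [yr yi] := psiP y; case: c => a b; apply: psi_eq.
    have -> : complex.Re ((a +i* b)%C * psi x + psi y) =
        a * complex.Re (psi x) - b * complex.Im (psi x) + complex.Re (psi y).
      by case: (psi x) => ? ?; case: (psi y).
    have -> : (fun k => complex.Re (phi k ((a +i* b)%C *: x + y))) =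
        (fun k => a * complex.Re (phi k x) - b * complex.Im (phi k x) +
                  complex.Re (phi k y)).
      apply/funext => k; rewrite (state_linear (st k)).
      by case: (phi k x) => ? ?; case: (phi k y).
    by apply: cvgD yr; apply: cvgB; apply: cvgM => //; exact: cvg_cst.
  have -> : complex.Im ((a +i* b)%C * psi x + psi y) =
      a * complex.Im (psi x) + b * complex.Re (psi x) + complex.Im (psi y).
    by case: (psi x) => ? ?; case: (psi y).
  have -> : (fun k => complex.Im (phi k ((a +i* b)%C *: x + y))) =
      (fun k => a * complex.Im (phi k x) + b * complex.Re (phi k x) +
                complex.Im (phi k y)).
    apply/funext => k; rewrite (state_linear (st k)).
    by case: (phi k x) => ? ?; case: (phi k y).
  by apply: cvgD yi; apply: cvgD; apply: cvgM => //; exact: cvg_cst.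
- have pos k : 0 = complex.Im (phi k x) /\ 0 <= complex.Re (phi k x).
    by have := state_ge0 (st k) x0; rewrite lecE => /andP[/eqP-> ->].
  have [xr xi] := psiP x; rewrite lecE; apply/andP; split.
    have im0 : (fun k => complex.Im (phi k x)) = cst 0.
      by apply/funext => k; rewrite -(pos k).1.
    by apply/eqP; rewrite im0 in xi; exact: (cvg_unique _ xi (cvg_cst _)).
  rewrite -(cvg_lim _ xr) //; apply: limr_ge; first exact: cvgP xr.
  by apply: nearW => k; exact: (pos k).2.
- have [r1 i1] := psiP 1; apply/eqP; rewrite eq_complex; apply/andP; split; apply/eqP.
    have e : (fun k => complex.Re (phi k 1)) = cst 1.
      by apply/funext => k; rewrite (state1 (st k)).
    by rewrite e in r1; exact: (cvg_unique _ r1 (cvg_cst _)).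
  have e : (fun k => complex.Im (phi k 1)) = cst 0.
    by apply/funext => k; rewrite (state1 (st k)).
  by rewrite e in i1; exact: (cvg_unique _ i1 (cvg_cst _)).
Qed.

End UltraLimits.

Section ComplexParts.
Context {R : realType}.

Lemma ReM (r : R) (z : R[i]) : complex.Re (r%:C%C * z) = r * complex.Re z.
Proof. by case: z => x y /=; rewrite mul0r subr0. Qed.

Lemma Re_sum (I : Type) (r : seq I) (E : I -> R[i]) :
  complex.Re (\sum_(i <- r) E i) = \sum_(i <- r) complex.Re (E i).
Proof. by apply: (big_morph (@complex.Re R)) => // -[? ?] [? ?]. Qed.

(** Reduces identities between linear functionals to identities between their real parts. *)
Lemma Re_Im (z : R[i]) : complex.Im z = complex.Re (- 'i%C * z).
Proof. by case: z => x y /=; rewrite oppr0 mul0r sub0r mulN1r opprK. Qed.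

End ComplexParts.

(** * Averages over finite sets of group elements *)

Section Actions.
Context {R : realType} {G : groupType} {A : cstarAlgType R} {Theta : G -> A -> A}.
Hypothesis act : star_action Theta.

Lemma action_linear g : linear (Theta g).
Proof. exact: star_hom_linear (action_hom act g). Qed.

(** By surjectivity, [Theta g 1] is a unit for the whole algebra. *)
Lemma action_unital g : Theta g 1 = 1.
Proof.
have [h _ hK] := action_bij act g.
by rewrite -[LHS]mulr1 -{2}(hK 1) -(star_hom_mul (action_hom act g)) mul1r hK.
Qed.

Lemma average_linear F : linear (average Theta F).
Proof.
move=> c x y; rewrite /average; under eq_bigr do rewrite action_linear.
by rewrite big_split -scaler_sumr /= scalerDr !scalerA mulrC.
Qed.

Lemma average_star F x : star (average Theta F x) = average Theta F (star x).
Proof.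
rewrite /average starZ fmorphV rmorph_nat; congr (_ *: _).
rewrite (big_morph _ (@starD R A) star0); apply: eq_bigr => g _.
by rewrite (star_hom_star (action_hom act g)).
Qed.

Lemma scalar_average (phi : A -> R[i]) F x : scalar phi ->
  phi (average Theta F x) = #|` F|%:R^-1 * \sum_(g <- F) phi (Theta g x).
Proof. by move=> lphi; rewrite (scalarfZ lphi) (scalarf_sum lphi). Qed.

Lemma average_unital (F : {fset G}) : F != fset0 -> average Theta F 1 = 1.
Proof.
move=> F0; rewrite /average (eq_bigr (fun=> 1)) => [|g _]; last exact: action_unital.
rewrite big_const_seq count_predT iter_addr_0 -[X in _ *: X]scaler_nat scalerA.
by rewrite mulVf ?scale1r // pnatr_eq0 cardfs_eq0.
Qed.

(** Stated for positive functionals because it also serves for the unnormalised forms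
    [inner (iM x u) u]. *)
Lemma average_positive (phi : A -> R[i]) F x : scalar phi ->
  (forall x, positive_elt x -> 0 <= phi x) ->
  positive_elt x -> 0 <= phi (average Theta F x).
Proof.
move=> lphi phi_ge0 [y ->]; rewrite scalar_average // mulr_ge0 ?invr_ge0 //.
apply: sumr_ge0 => g _; apply: phi_ge0; exists (Theta g y).
by rewrite (star_hom_mul (action_hom act g)) (star_hom_star (action_hom act g)).
Qed.

Lemma state_average (phi : A -> R[i]) F : F != fset0 -> state phi ->
  state (phi \o average Theta F).
Proof.
move=> F0 st; split=> [c x y|x x0|] /=.
- by rewrite average_linear (state_linear st).
- exact: average_positive (state_linear st) (state_ge0 st) x0.
- by rewrite average_unital // (state1 st).
Qed.

Lemma state_average_invariant (phi : A -> R[i]) F x :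
  (forall g, phi \o Theta g = phi) -> F != fset0 -> state phi ->
  phi (average Theta F x) = phi x.
Proof.
move=> inv F0 st; rewrite scalar_average; last exact: state_linear st.
rewrite (eq_bigr (fun=> phi x)) => [|g _]; last by rewrite -[in RHS](inv g).
rewrite big_const_seq count_predT iter_addr_0 -[X in _ * X]mulr_natl.
rewrite mulrA mulVf ?mul1r //.
by rewrite pnatr_eq0 cardfs_eq0.
Qed.

End Actions.

(** * Asymptotic invariance of averaged states *)

Section Folner.
Context {R : realType} {G : groupType}.

Lemma sum_translate (F : {fset G}) (h : G) (f : G -> R) :
  \sum_(g <- F) f (g * h)%g = \sum_(g <- right_translate F h) f g.
Proof.
rewrite /right_translate big_imfset //= => x y _ _.
exact: (@mulIg _ h).
Qed.

Lemma sum_sub_le (E F : {fset G}) (f : G -> R) K :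
  (forall g, `|f g| <= K) ->
  `|\sum_(g <- E) f g - \sum_(g <- F) f g| <= #|` sym_diff F E|%:R * K.
Proof.
(* Both sums are written over the union, where they cancel on the intersection. *)
move=> fK; pose S := (E `|` F)%fset.
have restrict (D : {fset G}) : (D `<=` S)%fset ->
    \sum_(g <- D) f g = \sum_(g <- S) f g *+ (g \in D).
  move=> DS; rewrite -(big_fset_incl _ DS) => [|g _ /negbTE->//].
  by rewrite !big_seq; apply: eq_bigr => g ->.
rewrite (restrict E) ?fsubsetUl // (restrict F) ?fsubsetUr // -sumrB.
rewrite -(@big_fset_incl _ _ _ _ (sym_diff F E)); last first.
- move=> g _; rewrite !inE; case: (g \in E); case: (g \in F) => //= _.
    by rewrite subrr.
  by rewrite subrr.
- by apply/fsubsetP => g; rewrite !inE; case: (g \in E); case: (g \in F).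
apply: le_trans (ler_norm_sum _ _ _) _.
apply: (@le_trans _ _ (\sum_(g <- sym_diff F E) K)).
  apply: ler_sum => g _; have := fK g; have := normr_ge0 (f g).
  by case: (g \in E); case: (g \in F);
    rewrite ?subrr ?subr0 ?sub0r ?normrN ?normr0 // => /le_trans h /h.
by rewrite big_const_seq count_predT iter_addr_0 mulr_natl.
Qed.

Lemma Re_average {A : cstarAlgType R} {Theta : G -> A -> A}
    {phi : A -> R[i]} (lphi : scalar phi) F b :
  complex.Re (phi (average Theta F b)) =
    #|` F|%:R^-1 * \sum_(g <- F) complex.Re (phi (Theta g b)).
Proof.
rewrite scalar_average // -Re_sum -ReM; congr (complex.Re (_ * _)).
by rewrite fmorphV rmorph_nat.
Qed.

(** Averaging [Theta h b] over [F k] sums over the right translate of [F k] by [h]. The bound on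
    states is uniform, so the state may vary with [k]. *)
Lemma Folner_average {A : cstarAlgType R} {Theta : G -> A -> A}
    (act : star_action Theta) (F : nat -> {fset G}) (FolnerF : Folner R F)
    (phi : nat -> A -> R[i]) (st : forall k, state (phi k)) h b :
  complex.Re (phi k (average Theta (F k) (Theta h b))) -
  complex.Re (phi k (average Theta (F k) b)) @[k --> \oo] --> (0 : R).
Proof.
have bnd k g : `|complex.Re (phi k (Theta g b))| <= cnorm b + 1.
  have := state_bound (state_comp (action_hom act g) (action_unital act g) _ (st k)) b.
  by case.
apply: norm_cvg0.
have c : (cnorm b + 1) * (#|` sym_diff (F k) (right_translate (F k) h)|%:R /
     #|` F k|%:R : R) @[k --> \oo] --> (0 : R).
  exact: cvg0M (Folner_lim FolnerF h).
apply: squeeze_cvgr (cvg_cst 0) c; apply: nearW => k; rewrite normr_ge0 /=.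
rewrite !Re_average; [|exact: state_linear (st k)..].
rewrite -mulrBr normrM ger0_norm ?invr_ge0 //.
rewrite [leRHS]mulrA [leRHS]mulrC ler_wpM2l ?invr_ge0 // [leRHS]mulrC.
have ThetaM g : Theta g (Theta h b) = Theta (g * h)%g b by rewrite (actionM act).
under eq_bigr do rewrite ThetaM.
rewrite (sum_translate (F k) h (fun g => complex.Re (phi k (Theta g b)))).
exact: sum_sub_le.
Qed.

End Folner.

(** If every vector state were at most [t] at [T], [cnorm_le_form] would give [||T|| <= t]. *)
Lemma norming_state {R : realType} {H : hilbertType R} {M : cstarAlgType R}
    {iM : M -> H -> H} (vn : von_neumann iM) (T : M) (t : R) :
  star T = T -> (forall u, 0 <= inner (iM T u) u) -> 0 <= t -> t < cnorm T ->
  exists phi : M -> R[i], state phi /\ t <= complex.Re (phi T).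
Proof.
move=> Ts T_ge0 t0 tT.
have [u uP] : exists u, ~ (0 <= inner (iM T u) u <= t%:C%C * inner u u).
  apply/existsNP => h; have := cnorm_le_form vn T t Ts t0 h.
  by rewrite leNgt tT.
move: uP => /negP; rewrite T_ge0 /=.
(* The order on [R[i]] is partial; both sides are nonnegative, hence real and comparable. *)
rewrite -real_ltNge ?ger0_real ?mulr_ge0 ?inner_ge0 ?T_ge0 ?ler0c // => lt.
have u0 : u != 0.
  apply/eqP => u0; move: lt; rewrite u0 inner0l mulr0.
  rewrite (linearf0 (proj1 (vn_bounded vn T))).
  by rewrite inner0l ltxx.
have uu : 0 < inner u u.
  rewrite lt_def inner_ge0 andbT; apply: contra u0 => /eqP/inner_eq0->//.
exists (fun x => (inner u u)^-1 * inner (iM x u) u); split.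
  exact: vector_state vn u u0.
have : t%:C%C <= (inner u u)^-1 * inner (iM T u) u.
  by rewrite mulrC ler_pdivlMr // ltW.
by rewrite lecE => /andP[].
Qed.

(** * The two bounds on the norms of the averages *)

Section Model.
Context {R : realType} {G : groupType} {H : hilbertType R} {M A : cstarAlgType R}.
Context {iM : M -> H -> H} {rho : M -> R[i]} {Xi : G -> M -> M}.
Context {Theta : G -> A -> A} {iota : A -> M}.
Hypotheses (sys : wstar_system iM rho Xi) (mod : cstar_model iM Xi Theta iota).

Let vn := wsys_von_neumann sys.
Let actM := wsys_action sys.
Let actA := model_action mod.
Let hi := model_hom mod.
Let i1 : iota 1 = 1 := model_unital vn mod.

Lemma iota_average F x : iota (average Theta F x) = average Xi F (iota x).
Proof.
rewrite /average (linearfZ (star_hom_linear hi)) (linearf_sum (star_hom_linear hi)).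
congr (_ *: _); apply: eq_bigr => g _.
by have /= <- := congr1 (fun f => f x) (model_equivariant mod g).
Qed.

(** Shows that the supremum in [msup] runs over a nonempty set. *)
Lemma Ann_ker_rho : Ann_ker Theta iota (rho \o iota).
Proof.
have str := wsys_state sys; split; last first.
  by move=> b /= ->; exact: scalarf0 (state_linear str).
split; first exact: state_comp hi i1 _ str.
move=> g; apply/funext => x /=.
have /= <- := congr1 (fun f => f x) (model_equivariant mod g).
by have /= -> := congr1 (fun f => f (iota x)) (wsys_invariant sys g).
Qed.

Lemma msup_ub a phi : Ann_ker Theta iota phi ->
  complex.Re (phi a) <= msup a (Ann_ker Theta iota).
Proof.
move=> hphi; apply: ub_le_sup; last by exists phi.
exists (cnorm a + 1) => _ [psi [[st _] _] <-].
by have [h _] := state_bound st a; exact: le_trans (ler_norm _) h.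
Qed.

Lemma msup_ge0 a : positive_elt a -> 0 <= msup a (Ann_ker Theta iota).
Proof.
move=> a0; apply: le_trans (msup_ub a _ Ann_ker_rho).
have st := state_comp hi i1 _ (wsys_state sys).
by have := state_ge0 st a0; rewrite lecE => /andP[].
Qed.

Lemma msup_le_cnorm_average a (F : {fset G}) : F != fset0 -> positive_elt a ->
  msup a (Ann_ker Theta iota) <= cnorm (average Xi F (iota a)).
Proof.
move=> F0 a0; apply: ge_sup.
  by exists (complex.Re ((rho \o iota) a)), (rho \o iota) => //; exact: Ann_ker_rho.
move=> _ [phi [[st inv] phi0] <-].
rewrite -(state_average_invariant phi F a inv F0 st) -iota_average.
apply: (state_le_cnorm vn hi i1 _ st phi0).
by rewrite (average_star actA) positive_selfadj.
Qed.

(** The strict inequality is placed inside the conclusion so that a state exists for every index and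
    a whole sequence can be chosen. *)
Lemma average_norming_state a t (F : {fset G}) : F != fset0 -> positive_elt a ->
  0 <= t -> exists phi : A -> R[i], [/\ state phi, forall b, iota b = 0 -> phi b = 0 &
    t < cnorm (average Xi F (iota a)) ->
    t <= complex.Re (phi (average Theta F a))].
Proof.
move=> F0 a0 t0; set T := average Xi F (iota a).
have pull psi : state psi -> state (psi \o iota) /\
    forall b, iota b = 0 -> (psi \o iota) b = 0.
  move=> st; split; first exact: state_comp hi i1 _ st.
  by move=> b /= ->; exact: scalarf0 (state_linear st).
have [tT|] := boolP (t < cnorm T); last first.
  (* The implication is vacuous here, and [rho \o iota] is a placeholder. *)
  by have [? ?] := pull _ (wsys_state sys); exists (rho \o iota).
have ia0 : positive_elt (iota a).
  case: a0 => y ->; exists (iota y).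
  by rewrite (star_hom_mul hi) (star_hom_star hi).
have [|u||//|psi [st le]] := norming_state vn T t.
- by rewrite (average_star actM) positive_selfadj.
- apply: (average_positive actM _ F _ (form_scalar vn u)) => // _ [y ->].
  by rewrite (form_star_mul vn) inner_ge0.
- exact: t0.
have [? ?] := pull _ st; exists (psi \o iota); split=> //= _.
by rewrite iota_average.
Qed.

Lemma cnorm_average_le_msup a (F : nat -> {fset G}) e : Folner R F ->
  positive_elt a -> 0 < e ->
  \forall k \near \oo,
    cnorm (average Xi (F k) (iota a)) <= msup a (Ann_ker Theta iota) + e.
Proof.
move=> FolnerF a0 e0; set t := msup a _ + e.
have t0 : 0 <= t by rewrite addr_ge0 ?msup_ge0 // ltW.
have F0 := Folner_neq0 FolnerF.
apply: contrapT => notnear.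
pose B := [set k | t < cnorm (average Xi (F k) (iota a))].
(* Since the bound fails infinitely often, [B] meets every tail; an ultrafilter can then contain [B]
   and all tails. *)
have properB : ProperFilter (within B \oo).
  apply: Build_ProperFilter_ex => D; rewrite /within /= => nD.
  apply: contrapT => /forallNP D0; apply: notnear.
  apply: filterS nD => k Dk; rewrite leNgt; apply/negP => Bk.
  exact: D0 (Dk Bk).
have [U [ultraU leU]] := ultraFilterLemma properB.
have PU := @ultra_proper _ _ ultraU.
have UB : U B by apply: leU; exact: withinT.
have leoo : \oo `<=` U.
  by move=> D oD; apply: leU; exact: filterS oD.
have /choice[phi phiP] k := average_norming_state a t (F k) (F0 k) a0 t0.
pose psi k := phi k \o average Theta (F k).
have stpsi k : state (psi k).
  by apply: state_average => //; case: (phiP k).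
have [chi [stchi cvgchi]] := state_ultralimit U psi ultraU stpsi.
(* The Følner limit along the tails is inherited by [U], which refines them. *)
have Re_inv h b : complex.Re (chi (Theta h b)) = complex.Re (chi b).
  have [rh _] := cvgchi (Theta h b); have [rb _] := cvgchi b.
  have d0 : complex.Re (psi k (Theta h b)) - complex.Re (psi k b)
      @[k --> U] --> (0 : R).
    move=> N N0; apply: leoo.
    by apply: (Folner_average actA F FolnerF phi) N0 => k; case: (phiP k).
  by apply/eqP; rewrite -subr_eq0; apply/eqP/(cvg_unique _ (cvgB rh rb) d0).
have Annchi : Ann_ker Theta iota chi.
  split; last first.
    move=> b b0.
    (* By equivariance, averaging preserves the kernel of [iota]. *)
    have psib0 k : psi k b = 0.
      have [_ kerk _] := phiP k; apply: kerk; rewrite iota_average b0.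
      exact: linearf0 (average_linear actM (F k)).
    have re0 : (fun k => complex.Re (psi k b)) = cst 0.
      by apply/funext => k; rewrite psib0.
    have im0 : (fun k => complex.Im (psi k b)) = cst 0.
      by apply/funext => k; rewrite psib0.
    have [r i] := cvgchi b; rewrite re0 in r; rewrite im0 in i.
    apply/eqP; rewrite eq_complex; apply/andP; split; apply/eqP.
      exact: (cvg_unique _ r (cvg_cst _)).
    exact: (cvg_unique _ i (cvg_cst _)).
  split=> // h; apply/funext => b /=; apply/eqP; rewrite eq_complex.
  (* The imaginary parts agree by applying [Re_inv] to [- 'i *: b]. *)
  rewrite Re_inv eqxx /= !Re_Im -!(scalarfZ (state_linear stchi)).
  by rewrite -(linearfZ (action_linear actA h)) Re_inv.
suff : t <= msup a (Ann_ker Theta iota) by rewrite /t gerDl leNgt e0.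
apply: le_trans (msup_ub a chi Annchi).
have [ra _] := cvgchi a.
rewrite -(cvg_lim _ ra) //; apply: limr_ge; first exact: cvgP ra.
(* On [B], a member of [U], the chosen states have real part at least [t] at the average of [a]. *)
by apply: filterS UB => k Bk; case: (phiP k) => _ _; exact.
Qed.

End Model.

Theorem mainTheorem1 (R : realType)
    (G : groupType) (countableG : countable [set: G])
    (amenableG : amenable R G)
    (H : hilbertType R) (M : cstarAlgType R) (iM : M -> H -> H)
    (rho : M -> R[i]) (Xi : G -> M -> M)
    (sysM : wstar_system iM rho Xi) (ergM : ergodic Xi)
    (A : cstarAlgType R) (Theta : G -> A -> A) (iota : A -> M)
    (modA : cstar_model iM Xi Theta iota)
    (F : nat -> {fset G}) (FolnerF : Folner R F)
    (a : A) (a_ge0 : positive_elt a) :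
  cnorm (average Xi (F k) (iota a)) @[k --> \oo]
    --> msup a (Ann_ker Theta iota).
Proof.
apply/cvgrPdist_le => e e0.
have := cnorm_average_le_msup sysM modA a F e FolnerF a_ge0 e0.
apply: filterS => k le_k.
(* This bound holds at every index, so the distance to the limit is a plain difference. *)
have ge_k := msup_le_cnorm_average sysM modA a (F k) (Folner_neq0 FolnerF k) a_ge0.
by rewrite distrC ger0_norm ?subr_ge0 // lerBlDl.
Qed.
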